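(* The scheme $X\subset\mathbb P^n_k$ has the Cayley-Bacharach property if and only if $\mathrm{core}(X)=\mathfrak m^{a+2}$.
   Context: $k$ is an infinite field and $X=\{P_1,\dots,P_s\}$ is a set of $s$ reduced points in $\mathbb P^n_k$ (with coordinates in $k$). $S=k[x_0,\dots,x_n]$ is the polynomial ring, $I_X$ the homogeneous vanishing ideal of $X$, $R=S/I_X$ the homogeneous coordinate ring (a one-dimensional Cohen-Macaulay ring), $\mathfrak m$ its homogeneous maximal ideal, and $a=a(R)=-\min\{i:[\omega_R]_i\ne0\}$ its $a$-invariant, where $\omega_R$ is the graded canonical module (normalized by $\omega_S=S(-n-1)$). Define $\mathrm{core}(X)=\mathrm{core}(\mathfrak m)$, where the core of an ideal $I$ is the intersection of all its reductions (ideals $K\subset I$ with $I^{r+1}=KI^r$ for some $r\ge0$). The scheme $X\subset\mathbb P^n_k$ has the Cayley-Bacharach property if the subschemes $X\setminus\{P_i\}\subset\mathbb P^n_k$, $1\le i\le s$, all have the same Hilbert function. *)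

(* Defs.v *)
From HB Require Import structures.
From mathcomp Require Import all_boot all_order all_algebra.
From mathcomp Require Import ring_quotient.
From mathcomp.multinomials Require Import mpoly.
From Stdlib Require ClassicalEpsilon.

Set Implicit Arguments.
Unset Strict Implicit.
Unset Printing Implicit Defensive.

Import GRing.Theory.
Local Open Scope ring_scope.

Definition infinite_field (k : fieldType) : Prop :=
  forall e : seq k, exists x, x \notin e.

Section Core.
Variable A : comNzRingType.
Implicit Types I J K : A -> Prop.

Definition subideal I J : Prop := forall x, I x -> J x.
Definition eqideal I J : Prop := forall x, I x <-> J x.

Definition is_ideal I : Prop :=
  [/\ I 0, forall x y, I x -> I y -> I (x + y) & forall a x, I x -> I (a * x)].

Definition ideal_mul I J : A -> Prop := fun x =>
  exists (m : nat) (u v : 'I_m -> A),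
    [/\ forall i, I (u i), forall i, J (v i) & x = \sum_(i < m) u i * v i].

Definition ideal_exp I (r : nat) : A -> Prop :=
  iter r (ideal_mul I) (fun=> True).

Definition reduction K I : Prop :=
  [/\ is_ideal K, subideal K I &
      exists r, eqideal (ideal_exp I r.+1) (ideal_mul K (ideal_exp I r))].

Definition core I : A -> Prop := fun x => forall K, reduction K I -> K x.

End Core.

(* The first local cohomology, in each degree, of a graded algebra A over k
   with respect to the ideal generated by homogeneous elements x_0, ..., x_m.-1
   of degree 1, computed by the Cech complex
     A -> \bigoplus_j A_(x_j) -> \bigoplus_(j < l) A_(x_j x_l),
   and its graded k-dual.  Here iota : k -> A gives the scalars and deg d is
   the homogeneous component of degree d : int.  The pair (g, N) stands for the
   fraction g / f ^ N of the localization A_f, the element f being given by the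
   context; a fraction has degree d if it is some g / f ^ N with g of degree
   d + N deg f. *)
Section Cech.
Variables (k : fieldType) (A : comNzRingType) (iota : k -> A).
Variables (deg : int -> A -> Prop) (m : nat) (x : 'I_m -> A).

Definition frac_eq (f : A) (u v : A * nat) : Prop :=
  exists M, f ^+ M * (f ^+ v.2 * u.1) = f ^+ M * (f ^+ u.2 * v.1).

(* The map A_f -> A_(f * h) : g / f ^ N = (h ^ N * g) / (f * h) ^ N. *)
Definition frac_res (h : A) (u : A * nat) : A * nat := (h ^+ u.2 * u.1, u.2).

Definition cochain : Type := 'I_m -> A * nat.

Definition cochain_add (u v : cochain) : cochain := fun j =>
  (x j ^+ (v j).2 * (u j).1 + x j ^+ (u j).2 * (v j).1, ((u j).2 + (v j).2)%N).

Definition cochain_scale (c : k) (u : cochain) : cochain := fun j =>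
  (iota c * (u j).1, (u j).2).

Definition cocycle (d : int) (u : cochain) : Prop :=
  (forall j, deg (d + (u j).2%:Z) (u j).1) /\
  (forall j l, frac_eq (x j * x l) (frac_res (x l) (u j)) (frac_res (x j) (u l))).

Definition coboundary (d : int) (u : cochain) : Prop :=
  exists2 h, deg d h & forall j, frac_eq (x j) (u j) (h, 0%N).

(* phi represents an element of Hom_k([H^1]_d, k): a linear form on the cocycles
   of degree d which vanishes on the coboundaries (its values on the other
   cochains are irrelevant). *)
Definition H1_form (d : int) (phi : cochain -> k) : Prop :=
  [/\ forall u v, cocycle d u -> cocycle d v ->
        phi (cochain_add u v) = phi u + phi v,
      forall c u, cocycle d u -> phi (cochain_scale c u) = c * phi u &
      forall u, cocycle d u -> coboundary d u -> phi u = 0].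

(* For a standard graded algebra A of Krull dimension 1 generated by the x_j,
   the graded canonical module is the graded dual Hom_k(H^1_m(A), k) of the top
   local cohomology, with [omega]_i = Hom_k([H^1_m(A)]_(-i), k).  This is the
   normalization for which omega_S = S(-n-1) when S = k[x_0, ..., x_n]. *)
Definition canonical_comp (i : int) : (cochain -> k) -> Prop := H1_form (- i).

Definition canonical_comp_neq0 (i : int) : Prop :=
  exists phi u, [/\ canonical_comp i phi, cocycle (- i) u & phi u != 0].

Definition is_a_invariant (a : int) : Prop :=
  canonical_comp_neq0 (- a) /\ forall i, canonical_comp_neq0 i -> - a <= i.

End Cech.

Section Points.
Variables (k : fieldType) (n : nat).
Local Notation S := {mpoly k[n.+1]}.

(* Finite nonempty sets of k-rational points of P^n, each point being given by
   one vector of homogeneous coordinates. *)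
Record point_set := PointSet {
  points :> seq 'rV[k]_n.+1;
  points_nonempty : points != [::];
  points_uniq : uniq points;
  points_neq0 : forall P, P \in points -> P != 0;
  points_nonprop :
    forall P Q c, P \in points -> Q \in points -> P = c *: Q -> P = Q }.

(* The ideal generated by the homogeneous polynomials vanishing on Y, i.e. the
   polynomials whose homogeneous components all vanish on Y. *)
Definition vanishing_ideal (Y : seq 'rV[k]_n.+1) : pred S := fun p =>
  all (fun P : 'rV[k]_n.+1 => [forall d : 'I_(msize p), (pihomog mdeg d p).@[P 0] == 0]) Y.

Definition cone_eval (P : 'rV[k]_n.+1) (p : S) : {poly k} :=
  mmap (@polyC k) (fun j => P 0 j *: 'X) p.

Lemma coef_cone_eval P p d : (cone_eval P p)`_d = (pihomog mdeg d p).@[P 0].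
Proof.
rewrite /cone_eval /mmap pihomogE raddf_sum /= coef_sum [RHS]big_mkcond /=.
apply: eq_bigr => m _.
rewrite coefCM /mmap1.
under eq_bigr do rewrite exprZn -mul_polyC.
rewrite big_split /= prodrXr -mdegE -rmorph_prod /= coefCM coefXn.
rewrite mevalZ mevalX eq_sym.
by case: (mdeg m == d); rewrite ?mulr1 ?mulr0.
Qed.

Lemma vanishing_idealP (Y : seq 'rV[k]_n.+1) (p : S) :
  reflect (forall P, P \in Y -> forall d, (pihomog mdeg d p).@[P 0] = 0)
          (p \in vanishing_ideal Y).
Proof.
apply: (iffP allP) => [h P /h /forallP hP d | h P PY].
  have [dp|dp] := ltnP d (msize p); first exact/eqP/(hP (Ordinal dp)).
  rewrite pihomogE big_seq_cond big1 ?meval0 // => m /andP[mp /eqP md].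
  by have := msize_mdeg_lt mp; rewrite md ltnNge dp.
by apply/forallP => d; rewrite h.
Qed.

Lemma vanishing_ideal_coneP (Y : seq 'rV[k]_n.+1) (p : S) :
  reflect (forall P, P \in Y -> cone_eval P p = 0) (p \in vanishing_ideal Y).
Proof.
apply: (iffP (vanishing_idealP Y p)) => h P PY.
  by apply/polyP => d; rewrite coef_cone_eval h // coef0.
by move=> d; rewrite -coef_cone_eval h // coef0.
Qed.

Lemma vanishing_ideal_closed (X : point_set) :
  idealr_closed (vanishing_ideal X).
Proof.
have mul P p q : cone_eval P (p * q) = cone_eval P p * cone_eval P q.
  by apply: rmorphM.
split.
- apply/vanishing_ideal_coneP => P _; exact: raddf0.
- case: X => [[|P Y] //= *]; apply/vanishing_ideal_coneP => /(_ P (mem_head _ _)).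
  rewrite /cone_eval rmorph1; exact/eqP/oner_neq0.
- move=> a u v /vanishing_ideal_coneP hu /vanishing_ideal_coneP hv.
  apply/vanishing_ideal_coneP => P PX.
  by rewrite /cone_eval raddfD /= -!/(cone_eval _ _) mul hu // hv // mulr0 addr0.
Qed.

Section CoordRing.
Variable X : point_set.

Definition ideal_of_points : S -> bool := vanishing_ideal X.

HB.instance Definition _ :=
  isIdealr.Build S ideal_of_points (vanishing_ideal_closed X).

Definition points_ideal : idealr S := ideal_of_points.

Definition coord_ring : comNzRingType := {ideal_quot points_ideal}.

Definition coord_proj (p : S) : coord_ring := \pi_({ideal_quot points_ideal})%qT p.

Definition coord_scalar (c : k) : coord_ring := coord_proj c%:MP.

Definition coord_var (j : 'I_n.+1) : coord_ring := coord_proj 'X_j.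

Definition coord_deg (d : int) (g : coord_ring) : Prop :=
  match d with
  | Posz e => exists2 p : S, p \is e.-homog & g = coord_proj p
  | Negz _ => g = 0
  end.

Definition irrelevant_ideal : coord_ring -> Prop := fun g =>
  exists c : 'I_n.+1 -> coord_ring, g = \sum_j c j * coord_var j.

Definition core_of_points : coord_ring -> Prop := core irrelevant_ideal.

(* Such an integer exists and is unique, so the default value plays no role. *)
Definition a_invariant : int :=
  ClassicalEpsilon.epsilon (inhabits 0)
    (is_a_invariant coord_scalar coord_deg coord_var).

End CoordRing.

(* The component of degree d of the vanishing ideal of Y. *)
Definition vanishing_comp (Y : seq 'rV[k]_n.+1) (d : nat) :
    {vspace dhomog n.+1 k d} :=
  (\bigcap_(P <- Y)
     lker (linfun (fun f : dhomog n.+1 k d =>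
                   (mpoly_of_dhomog f).@[P 0%R] : k^o)))%VS.

Lemma mem_vanishing_comp Y d (f : dhomog n.+1 k d) :
  (f \in vanishing_comp Y d) = (mpoly_of_dhomog f \in vanishing_ideal Y).
Proof.
have lin P : linear (fun f : dhomog n.+1 k d => (mpoly_of_dhomog f).@[P] : k^o).
  by move=> c p q /=; rewrite linearP.
have evE P : linfun (fun f : dhomog n.+1 k d => (mpoly_of_dhomog f).@[P] : k^o) f
             = (mpoly_of_dhomog f).@[P].
  pose L := GRing.isLinear.Build _ _ _ _ _ (lin P).
  pose F : {linear _ -> k^o} := HB.pack
    (fun f : dhomog n.+1 k d => (mpoly_of_dhomog f).@[P] : k^o) L.
  exact: (lfunE F).
have -> : (f \in vanishing_comp Y d) =
          all (fun P : 'rV[k]_n.+1 => (mpoly_of_dhomog f).@[P 0] == 0) Y.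
  rewrite /vanishing_comp; elim: Y => [|P Y IH]; first by rewrite big_nil memvf.
  by rewrite big_cons memv_cap IH memv_ker evE.
have hf := dhomog_is_dhomog f.
apply/allP/vanishing_idealP => h P PY; last first.
  by rewrite -[X in X.@[_]](pihomog_dE hf) h.
move=> e; have [<-|de] := eqVneq d e.
  by rewrite pihomog_dE //; apply/eqP/h.
by rewrite (pihomog_ne0 de hf) meval0.
Qed.

(* dim_k [S / I_Y]_d *)
Definition hilbert_function (Y : seq 'rV[k]_n.+1) (d : nat) : nat :=
  (\dim {: dhomog n.+1 k d} - \dim (vanishing_comp Y d))%N.

Definition cayley_bacharach (X : point_set) : Prop :=
  forall P Q, P \in points X -> Q \in points X ->
    hilbert_function (rem P X) =1 hilbert_function (rem Q X).

End Points.

Arguments irrelevant_ideal {k n} X.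
Arguments core_of_points {k n} X.

(* Main.v *)
From HB Require Import structures.
Require Import Defs.
From mathcomp Require Import all_boot all_order all_algebra.
From mathcomp.multinomials Require Import mpoly.
From mathcomp Require Import ring zify.
From Stdlib Require ClassicalEpsilon Classical.

(**
Restricting to the line over each point P_i embeds R into the product of s
copies of k[t] (one for each point): the map [ray i] sends a form p of degree d
to p(P_i) t^d.  Write V_d for the image of R_d in k^s.  A form of degree d which
vanishes at all points but P_i, and not there, exists exactly when the basis
vector e_i lies in V_d ([separated d i]); this property passes from d to d + 1.
Let sigma be the least d for which every P_i is separated, that is V_d = k^s.
Four facts give the theorem.

The a-invariant is sigma - 1 ([a_invariantE]): evaluating Cech cocycles at the
points identifies H^1_m(R) in degree d with k^s / V_d, where V_d = 0 for d < 0.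

Removing P_i lowers the Hilbert function in degree d by 1 if P_i is separated
in degree d, and by 0 otherwise.  So X has the Cayley-Bacharach property if and
only if in each degree all or none of the points are separated
([cayley_bacharachP]); equivalently, no point is separated in degree sigma - 1.

Every reduction of m contains m^(sigma + 1) ([reduction_contains]).  Indeed a
reduction contains an element y whose linear part vanishes at none of the points,
and R contains t^sigma times the product of the k[t] ([conductor]), so that an
element of m^(sigma + 1) can be divided by y degree by degree.  Hence m^(a + 2)
lies in the core in all cases.

The core is strictly larger exactly when some P_i is separated in degree
sigma - 1.  If q is a separator of P_i in that degree, then multiplying q by y
as above shows that e_i t^sigma, which is not in m^(sigma + 1), lies in every
reduction ([separated_core_element]).  Conversely let g be in the core, with a
component in degree d <= sigma whose value at P_i is nonzero.  Each linear form l
without zeros on X generates a reduction, so the vector (g_j / l(P_j))_j of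
degree d components lies in V_(d-1) for all such l.  Letting l degenerate to a
linear form that vanishes at P_i only forces e_i to lie in V_(d-1)
([core_separated]), hence in V_(sigma-1).
*)

Set Implicit Arguments.
Unset Strict Implicit.
Unset Printing Implicit Defensive.

Import Order.TTheory GRing.Theory Num.Theory.
Local Open Scope ring_scope.

(** * Preliminaries *)

(** An arbitrary predicate becomes boolean by excluded middle, so that [ex_minn]
applies. *)
Lemma least_nat (Q : nat -> Prop) :
  (exists d, Q d) -> exists s, Q s /\ forall d, (d < s)%N -> ~ Q d.
Proof.
pose b d : bool := ClassicalEpsilon.excluded_middle_informative (Q d).
have bP d : reflect (Q d) (b d) by apply: sumboolP.
move=> exQ; have exb : exists d, b d by case: exQ => d /bP; exists d.
exists (ex_minn exb); case: ex_minnP => s /bP Qs smin; split=> // d ds /bP /smin.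
by rewrite leqNgt ds.
Qed.

Lemma infinite_nonroot (k : fieldType) (p : {poly k}) :
  infinite_field k -> p != 0 -> exists x, p.[x] != 0.
Proof.
move=> k_inf p0.
have [e [ue se]] : exists e : seq k, uniq e /\ size e = size p.
  elim: (size p) => [|N [e [ue se]]]; first by exists [::].
  by have [x xe] := k_inf e; exists (x :: e); rewrite /= xe ue se.
have : ~~ all (root p) e.
  by apply/negP => h; have := max_poly_roots p0 h ue; rewrite se ltnn.
by case/allPn => x _; exists x.
Qed.

(** A generic member of a line u + c v is nonzero at each place where u or v is:
the product over i of the polynomials u_i + v_i c in c is nonzero, and an
infinite field has a point where it does not vanish. *)
Lemma general_position (k : fieldType) (I : eqType) (r : seq I) (V : (I -> k) -> Prop) :
  infinite_field k ->
  (exists u, V u) ->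
  (forall u v c, V u -> V v -> V (fun i => u i + v i * c)) ->
  (forall i, i \in r -> exists2 u, V u & u i != 0) ->
  exists2 u, V u & forall i, i \in r -> u i != 0.
Proof.
move=> k_inf [u0 V0] VD; elim: r => [_|i r IH h]; first by exists u0.
have [l lr|u Vu ur] := IH; first by apply: h; rewrite inE lr orbT.
have [v Vv vi] := h i (mem_head _ _).
pose p : {poly k} := \prod_(l <- i :: r) ((u l)%:P + v l *: 'X).
have p0 : p != 0.
  rewrite prodf_seq_neq0; apply/allP => l lr /=; apply/eqP => /polyP E.
  have := E 0%N; have := E 1%N; rewrite !coefD !coefC !coefZ !coefX /=.
  rewrite mulr0 mulr1 add0r addr0 => v0 u0'.
  move: lr; rewrite inE => /orP[/eqP li|/ur]; last by rewrite u0' eqxx.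
  by move: vi; rewrite -li v0 eqxx.
have [c] := infinite_nonroot k_inf p0.
rewrite horner_prod prodf_seq_neq0 => /allP pc.
exists (fun l => u l + v l * c); first exact: VD.
by move=> l /pc /=; rewrite hornerD hornerC hornerZ hornerX.
Qed.

Lemma drop_poly_factor (A : nzRingType) (p : {poly A}) N :
  (forall d, (d < N)%N -> p`_d = 0) ->
  p = drop_poly N p * 'X^N.
Proof.
move=> h; rewrite -[LHS](poly_take_drop N) [take_poly N p](_ : _ = 0) ?add0r //.
by apply/polyP => d; rewrite coef_take_poly coef0; case: ifP => // /h.
Qed.

Section Ideals.
Variable A : comNzRingType.
Implicit Types I J : A -> Prop.

Lemma ideal_mul_ideal I J : is_ideal J -> is_ideal (ideal_mul I J).
Proof.
case=> J0 JD JM; split.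
- by exists 0%N, (fun=> 0), (fun=> 0); split=> [[]|[]|] //; rewrite big_ord0.
- move=> x y [a [u [v [hu hv ->]]]] [b [u' [v' [hu' hv' ->]]]].
  pose glue w w' (l : 'I_(a + b)) : A :=
    match split l with inl i => w i | inr i => w' i end.
  exists (a + b)%N, (glue u u'), (glue v v'); split.
  + by move=> l; rewrite /glue; case: split.
  + by move=> l; rewrite /glue; case: split.
  rewrite big_split_ord /=; congr (_ + _); apply: eq_bigr => i _; rewrite /glue.
    by case: split_ordP => j /eqP; rewrite ?eq_lshift ?eq_lrshift // => /eqP ->.
  by case: split_ordP => j /eqP; rewrite ?eq_rshift ?eq_rlshift // => /eqP ->.
- move=> a x [b [u [v [hu hv ->]]]]; exists b, u, (fun i => a * v i); split=> //.
    by move=> i; apply: JM.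
  by rewrite mulr_sumr; apply: eq_bigr => i _; rewrite mulrCA.
Qed.

Lemma ideal_exp_ideal I r : is_ideal (ideal_exp I r).
Proof. by elim: r => [|r IH]; [|apply: ideal_mul_ideal]. Qed.

Lemma ideal_mul1 I J (u v : A) : I u -> J v -> ideal_mul I J (u * v).
Proof. by move=> hu hv; exists 1%N, (fun=> u), (fun=> v); split=> //; rewrite big_ord1. Qed.

Lemma ideal_sum J T (r : seq T) (Q : pred T) (F : T -> A) :
  is_ideal J -> (forall t, Q t -> J (F t)) -> J (\sum_(t <- r | Q t) F t).
Proof. by case=> J0 JD JM h; apply: big_ind. Qed.

End Ideals.

(** * The coordinate ring inside a product of polynomial rings *)

Section CoordRingOfPoints.
Variables (k : fieldType) (n : nat) (X : point_set k n).
Local Notation S := {mpoly k[n.+1]}.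
Local Notation R := (coord_ring X).
Local Notation pr := (coord_proj X).
Local Notation mm := (irrelevant_ideal X).

Definition pt (i : 'I_(size X)) : 'rV[k]_n.+1 := tnth (in_tuple X) i.

Lemma pt_in i : pt i \in points X.
Proof. exact: mem_tnth. Qed.

Lemma ptP P : P \in points X -> exists i, P = pt i.
Proof. by move=> PX; have /tnthP[i ->] : P \in in_tuple X by []; exists i. Qed.

Lemma pt_inj : injective pt.
Proof. by apply/tuple_uniqP; exact: points_uniq. Qed.

Lemma pt_coord i : exists j, pt i 0 j != 0.
Proof. by apply/rV0Pn; apply: points_neq0 (pt_in i). Qed.

Lemma proj_is_zmod_morphism : zmod_morphism pr.
Proof. by move=> p q; rewrite /coord_proj !rmorphB. Qed.
Lemma proj_is_monoid_morphism : monoid_morphism pr.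
Proof. by split=> [|p q]; rewrite /coord_proj ?rmorph1 ?rmorphM. Qed.
HB.instance Definition _ := GRing.isZmodMorphism.Build S R pr proj_is_zmod_morphism.
HB.instance Definition _ := GRing.isMonoidMorphism.Build S R pr proj_is_monoid_morphism.

HB.instance Definition _ (P : 'rV[k]_n.+1) :=
  GRing.RMorphism.copy (cone_eval P) (mmap (@polyC k) (fun j => P 0 j *: 'X)).

(** Equality in R is tested on the lines over the points.  This makes R a subring
of a product of polynomial rings. *)
Lemma proj_eq p q : pr p = pr q <-> forall i, cone_eval (pt i) p = cone_eval (pt i) q.
Proof.
have -> : (pr p = pr q) <-> p - q \in vanishing_ideal X.
  have := Quotient.idealrBE (points_ideal X) p q => E.
  rewrite -[p - q \in vanishing_ideal X]/(p - q \in points_ideal X) E.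
  by split=> /eqP.
split=> [/vanishing_ideal_coneP h i|h].
  by apply/eqP; rewrite -subr_eq0 -rmorphB /= h ?pt_in.
apply/vanishing_ideal_coneP => P /ptP[i ->].
by rewrite rmorphB /= h subrr.
Qed.

Lemma proj_surj g : exists p, g = pr p.
Proof. by exists (repr g); rewrite /coord_proj reprK. Qed.

(** The restriction of g to the line spanned by the i-th point, the parameter t
being the variable of {poly k}. *)
Definition ray i (g : R) : {poly k} := cone_eval (pt i) (repr g).

Lemma ray_proj i p : ray i (pr p) = cone_eval (pt i) p.
Proof.
by move: i; apply/proj_eq; rewrite {1}/coord_proj reprK.
Qed.

Lemma ray_is_zmod_morphism i : zmod_morphism (ray i).
Proof.
move=> g h; have [p ->] := proj_surj g; have [q ->] := proj_surj h.
by rewrite -rmorphB /= !ray_proj rmorphB.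
Qed.
Lemma ray_is_monoid_morphism i : monoid_morphism (ray i).
Proof.
split=> [|g h]; first by rewrite -(rmorph1 pr) /= ray_proj rmorph1.
have [p ->] := proj_surj g; have [q ->] := proj_surj h.
by rewrite -rmorphM /= !ray_proj rmorphM.
Qed.
HB.instance Definition _ i :=
  GRing.isZmodMorphism.Build R {poly k} (ray i) (ray_is_zmod_morphism i).
HB.instance Definition _ i :=
  GRing.isMonoidMorphism.Build R {poly k} (ray i) (ray_is_monoid_morphism i).

Lemma ray_inj g h : (forall i, ray i g = ray i h) -> g = h.
Proof.
have [p ->] := proj_surj g; have [q ->] := proj_surj h => E.
by apply/proj_eq => i; rewrite -!ray_proj.
Qed.

Lemma cone_eval_var (P : 'rV[k]_n.+1) j : cone_eval P 'X_j = P 0 j *: 'X.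
Proof. by rewrite /cone_eval mmapX mmap1U. Qed.

Lemma cone_eval_const (P : 'rV[k]_n.+1) c : cone_eval P c%:MP = c%:P.
Proof. exact: mmapC. Qed.

Lemma cone_eval_homog (P : 'rV[k]_n.+1) d p : p \is d.-homog -> cone_eval P p = p.@[P 0] *: 'X^d.
Proof.
move=> hp; apply/polyP => e; rewrite coef_cone_eval coefZ coefXn.
have [->|ed] := eqVneq e d; first by rewrite mulr1 pihomog_dE.
by rewrite mulr0 (pihomog_ne0 _ hp) ?meval0 // eq_sym.
Qed.

Lemma cone_eval_at1 (P : 'rV[k]_n.+1) p : (cone_eval P p).[1] = p.@[P 0].
Proof.
rewrite [p](pihomog_partitionE (leqnn (mmeasure mdeg p))) !rmorph_sum horner_sum.
apply: eq_bigr => d _.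
by rewrite /= (cone_eval_homog _ (pihomogP _ _ _)) hornerZ hornerXn expr1n mulr1.
Qed.

Lemma ray_var i j : ray i (coord_var X j) = pt i 0 j *: 'X.
Proof. by rewrite ray_proj cone_eval_var. Qed.
Lemma ray_scalar i c : ray i (coord_scalar X c) = c%:P.
Proof. by rewrite ray_proj cone_eval_const. Qed.

(** Order of vanishing along t = 0 on all the lines; [irrelevant_expP] shows that
this describes the powers of the irrelevant ideal. *)
Definition vanish_order N (g : R) := forall i d, (d < N)%N -> (ray i g)`_d = 0.

Lemma vanish_orderM1 N u v : vanish_order 1 u -> vanish_order N v ->
  vanish_order N.+1 (u * v).
Proof.
move=> hu hv i d dN; rewrite rmorphM coefM big1 // => -[[|e] /= ed] _.
  by rewrite hu ?mul0r.
rewrite hv ?mulr0 //; case: d dN ed => // d; rewrite !ltnS subSS => dN _.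
exact: leq_ltn_trans (leq_subr _ _) dN.
Qed.

Lemma irrelevant_order g : mm g -> vanish_order 1 g.
Proof.
case=> c -> i [|//] _; rewrite rmorph_sum coef_sum big1 // => j _.
by rewrite rmorphM /= ray_var -scalerAr coefZ coefMX mulr0.
Qed.

Lemma var_irrelevant j : mm (coord_var X j).
Proof.
exists (fun l => (l == j)%:R); rewrite (bigD1 j) //= eqxx mul1r big1 ?addr0 // => l.
by move/negbTE ->; rewrite mul0r.
Qed.

Lemma irrelevant_is_ideal : is_ideal mm.
Proof.
split.
- by exists (fun=> 0); rewrite big1 // => j _; rewrite mul0r.
- move=> x y [c ->] [e ->]; exists (fun j => c j + e j).
  by rewrite -big_split; apply: eq_bigr => j _; rewrite mulrDl.
- move=> a x [c ->]; exists (fun j => a * c j).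
  by rewrite mulr_sumr; apply: eq_bigr => j _; rewrite mulrA.
Qed.

Lemma monomial_exp N (m : 'X_{1..n.+1}) : (N <= mdeg m)%N -> ideal_exp mm N (pr 'X_[m]).
Proof.
elim: N m => [//|N IH] m Nm.
have [j mj] : exists j, m j != 0%N.
  by apply/existsP; rewrite -negb_forall; apply/negP => /forallP h;
     move: Nm; rewrite mdegE big1 // => j _; apply/eqP.
have E : m = (U_(j) + (m - U_(j)))%MM.
  by rewrite addmC submK //; apply/mnm_lepP => l; rewrite mnm1E; case: eqP => // <-; rewrite lt0n.
rewrite E mpolyXD rmorphM; apply: ideal_mul1; first exact: var_irrelevant.
by apply: IH; move: Nm; rewrite {1}E mdegD mdeg1 add1n.
Qed.

(** Modulo the ideal of the points a polynomial may be replaced by its part of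
degree at least N when its lower components vanish on X, and a monomial of degree
at least N is a product of N variables and another monomial. *)
Lemma irrelevant_expP N g : ideal_exp mm N g <-> vanish_order N g.
Proof.
split.
  elim: N g => [g _ i d //|N IH g /= [a [u [v [hu hv ->]]]] i d dN].
  rewrite rmorph_sum coef_sum big1 // => l _.
  by apply: (vanish_orderM1 (irrelevant_order (hu l)) (IH _ (hv l))).
have [p ->] := proj_surj g => h.
have -> : pr p = pr (\sum_(m <- msupp p | (N <= mdeg m)%N) p@_m *: 'X_[m]).
  apply/proj_eq => i; rewrite {1}[p]mpolyE (bigID (fun m => (N <= mdeg m)%N)) /= rmorphD.
  rewrite -[RHS]addr0; congr (_ + _); apply/polyP => d; rewrite coef0.
  have [dN|Nd] := ltnP d N.
    rewrite -[RHS](h i d dN) ray_proj !coef_cone_eval; congr (_.@[_]).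
    rewrite [RHS]pihomogE raddf_sum [RHS]big_mkcond [LHS]big_mkcond; apply: eq_bigr => m _ /=.
    rewrite linearZ /= pihomogX; have [md|] := eqVneq (mdeg m) d; last by rewrite scaler0 if_same.
    by rewrite -ltnNge md dN.
  rewrite rmorph_sum coef_sum big1 // => m; rewrite -ltnNge => mN.
  rewrite coef_cone_eval linearZ /= pihomogX.
  case: eqP mN => [->|_ _]; last by rewrite scaler0 meval0.
  by rewrite ltnNge Nd.
rewrite rmorph_sum; apply: ideal_sum; first exact: ideal_exp_ideal.
move=> m Nm; rewrite -mul_mpolyC rmorphM.
by have [_ _] := ideal_exp_ideal mm N; apply; apply: monomial_exp.
Qed.

Lemma irrelevantP g : mm g <-> vanish_order 1 g.
Proof.
split; first exact: irrelevant_order.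
move/irrelevant_expP => [a [u [v [hu _ ->]]]].
apply: ideal_sum => [|l _]; first exact: irrelevant_is_ideal.
by have [_ _ h] := irrelevant_is_ideal; rewrite mulrC; apply: h.
Qed.

End CoordRingOfPoints.

(** * Separating the points by forms *)

Section Separators.
Variables (k : fieldType) (n : nat) (X : point_set k n).
Local Notation S := {mpoly k[n.+1]}.
Local Notation R := (coord_ring X).
Local Notation pr := (coord_proj X).
Local Notation mm := (irrelevant_ideal X).
Local Notation ptX := (@pt k n X).

Definition separated d (i : 'I_(size X)) : Prop :=
  exists2 p : S, p \is d.-homog & forall j, p.@[ptX j 0] = (j == i)%:R.

Lemma separated_of_neq0 d i p : p \is d.-homog -> p.@[ptX i 0] != 0 ->
  (forall j, j != i -> p.@[ptX j 0] = 0) -> separated d i.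
Proof.
move=> hp pi pj; exists (p.@[ptX i 0]^-1 *: p); first exact: dhomogZ.
move=> j; rewrite mevalZ; case: eqP => [->|/eqP/pj ->]; last by rewrite mulr0.
by rewrite mulVf.
Qed.

(** Multiply a separator of P_i by a coordinate that is nonzero at P_i. *)
Lemma separatedS d i : separated d i -> separated d.+1 i.
Proof.
case=> p hp pE; have [l Pl] := pt_coord i.
apply: (@separated_of_neq0 _ _ (p * 'X_l)).
- have h1 : ('X_l : S) \is 1.-homog by rewrite dhomogX /= mdeg1.
  by have := dhomogM hp h1; rewrite addn1.
- by rewrite mevalM mevalXU pE eqxx mul1r.
- by move=> j /negbTE ji; rewrite mevalM pE ji mul0r.
Qed.

Lemma separated_leq d e i : (d <= e)%N -> separated d i -> separated e i.
Proof.
move=> /subnK <-; elim: (e - d)%N => // N IH h; exact/separatedS/IH.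
Qed.

(** Distinct points have nonproportional coordinates, so some 2 by 2 minor of their
coordinates is nonzero; it is the value at P_i of a linear form through P_j. *)
Lemma linear_separator i j : j != i -> exists2 p : S, p \is 1.-homog &
  p.@[ptX j 0] = 0 /\ p.@[ptX i 0] != 0.
Proof.
move=> ji; have [b Pb] := pt_coord j.
have [/forallP h|] := boolP [forall a, ptX i 0 a * ptX j 0 b == ptX i 0 b * ptX j 0 a].
  case/eqP: ji; apply/esym/pt_inj.
  apply: (points_nonprop (pt_in i) (pt_in j) (c := ptX i 0 b / ptX j 0 b)).
  apply/rowP => a; rewrite !mxE -[LHS](mulfK Pb) (eqP (h a)).
  by rewrite mulrAC.
rewrite negb_forall => /existsP[a hab].
exists (ptX j 0 b *: 'X_a - ptX j 0 a *: 'X_b).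
  by rewrite rpredB // dhomogZ // dhomogX /= mdeg1.
rewrite !mevalB !mevalZ !mevalXU subr_eq0; split; first by rewrite mulrC subrr.
by rewrite mulrC [X in _ != X]mulrC.
Qed.

(** The product of linear forms, one through each of the other points, separates
P_i. *)
Lemma separated_ex i : exists d, separated d i.
Proof.
have [L hL] : exists L : 'I_(size X) -> S, forall j, j != i ->
    [/\ L j \is 1.-homog, (L j).@[ptX j 0] = 0 & (L j).@[ptX i 0] != 0].
  apply: (fin_all_exists (P := fun j (p : S) => j != i ->
    [/\ p \is 1.-homog, p.@[ptX j 0] = 0 & p.@[ptX i 0] != 0])) => j.
  have [->|/linear_separator[p hp [pj pi]]] := eqVneq j i; last by exists p.
  by exists 0.
exists (\sum_(j | j != i) 1)%N; apply: (@separated_of_neq0 _ _ (\prod_(j | j != i) L j)).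
- apply: (big_ind2 (fun (p : S) d => p \is d.-homog)) => [|p d q e|j /hL[]//].
    exact: dhomog1.
  by move=> hp hq; apply: dhomogM hp hq.
- by rewrite rmorph_prod; apply/prodf_neq0 => j /hL[].
- move=> j ji; rewrite rmorph_prod (bigD1 j) //=.
  by have [_ -> _] := hL j ji; rewrite mul0r.
Qed.

Definition all_separated d := forall i, separated d i.

Lemma all_separated_ex : exists d, all_separated d.
Proof.
have [d hd] := fin_all_exists separated_ex.
by exists (\max_i d i)%N => i; apply: separated_leq (hd i); apply: leq_bigmax.
Qed.

Lemma interpolate d : all_separated d -> forall w : 'I_(size X) -> k,
  exists2 p : S, p \is d.-homog & forall j, p.@[ptX j 0] = w j.
Proof.
move=> hd w.
have [q hq] : exists q : 'I_(size X) -> S, forall i, q i \is d.-homog /\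
    forall j, (q i).@[ptX j 0] = (j == i)%:R.
  apply: (fin_all_exists (P := fun i (p : S) => p \is d.-homog /\
    forall j, p.@[ptX j 0] = (j == i)%:R)) => i.
  by have [p] := hd i; exists p.
exists (\sum_i w i *: q i).
  by apply: rpred_sum => i _; apply: dhomogZ; have [] := hq i.
move=> j; rewrite raddf_sum (bigD1 j) //= mevalZ (hq j).2 eqxx mulr1 big1 ?addr0 //.
by move=> i; rewrite eq_sym mevalZ (hq i).2 => /negbTE ->; rewrite mulr0.
Qed.

Lemma ray_separator d i p : (forall j, p.@[ptX j 0] = (j == i)%:R) ->
  p \is d.-homog -> forall j, ray j (pr p) = (j == i)%:R *: 'X^d.
Proof. by move=> pE hp j; rewrite ray_proj (cone_eval_homog _ hp) pE. Qed.

(** If all points are separated in degree s, the conductor of R in its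
normalization, the product of the k[t], contains t^s.  On the line over P_i the
ring R already contains t, as a multiple of a coordinate that is nonzero at P_i.
So multiplying the separator e_i t^s of P_i by a polynomial in that element gives
any multiple of e_i t^s. *)
Lemma conductor s : all_separated s ->
  forall f : 'I_(size X) -> {poly k}, exists z, forall i, ray i z = f i * 'X^s.
Proof.
move=> hs f.
have [z hz] : exists z : 'I_(size X) -> R,
    forall i j, ray j (z i) = (j == i)%:R *: (f i * 'X^s).
  apply: (fin_all_exists (P := fun i z => forall j, ray j z = _)) => i.
  have [p hp pE] := hs i.
  elim/poly_ind: (f i) => [|g c [z hz]].
    by exists 0 => j; rewrite rmorph0 mul0r scaler0.
  have [l Pl] := pt_coord i.
  exists (z * (coord_scalar X (pt i 0 l)^-1 * coord_var X l) + coord_scalar X c * pr p).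
  move=> j; rewrite rmorphD !rmorphM /= hz !ray_scalar ray_var (ray_separator pE hp).
  case: eqP => [->|_]; last by rewrite !scale0r mul0r mulr0 addr0.
  rewrite !scale1r mul_polyC scalerA mulVf // scale1r mulrDl; congr (_ + _).
  by rewrite -!mulrA -exprSr -exprS.
exists (\sum_i z i) => j; rewrite rmorph_sum (bigD1 j) //= hz eqxx scale1r big1 ?addr0 //.
by move=> i; rewrite eq_sym hz => /negbTE ->; rewrite scale0r.
Qed.

(** On each line l is a unit times t, so by [conductor] an element of m^(s+1) is l
times an element of m^s: l m^s = m^(s+1). *)
Lemma principal_reduction s (l : R) (c : 'I_(size X) -> k) : all_separated s ->
  (forall i, c i != 0) -> (forall i, ray i l = c i *: 'X) ->
  reduction (fun x => exists z, x = l * z) mm.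
Proof.
move=> hs c0 lE.
have lm : mm l by apply/irrelevantP => i [|//] _; rewrite lE coefZ coefX mulr0.
have [m0 mD mM] := irrelevant_is_ideal X.
split; [split | | exists s => g; split].
- by exists 0; rewrite mulr0.
- by move=> _ _ [z ->] [w ->]; exists (z + w); rewrite mulrDr.
- by move=> a _ [z ->]; exists (a * z); rewrite mulrCA.
- by move=> _ [z ->]; rewrite mulrC; apply: mM.
- move/irrelevant_expP => hg.
  have [z hz] := conductor hs (fun i => (c i)^-1 *: drop_poly s.+1 (ray i g)).
  have -> : g = l * z.
    apply: ray_inj => i; rewrite rmorphM /= lE hz {1}(drop_poly_factor (hg i)).
    rewrite -!scalerAl -scalerAr scalerA mulfV // scale1r.
    by rewrite mulrCA -exprS.
  apply: ideal_mul1; first by exists 1; rewrite mulr1.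
  by apply/irrelevant_expP => i d ds; rewrite hz coefMXn ds.
- case=> a [u [v [hu hv ->]]]; exists a, u, v; split=> // i.
  by have [w ->] := hu i; rewrite mulrC; apply: mM.
Qed.

(** If all linear parts of K vanished at P_i, then K m^r would have order at least
r + 2 on the line over P_i.  But a coordinate that is nonzero at P_i has an
(r+1)-st power of order r + 1 there. *)
Lemma reduction_coef1 K i : reduction K mm -> exists2 y, K y & (ray i y)`_1 != 0.
Proof.
case=> _ KI [r hr]; have [l Pl] := pt_coord i.
have : ideal_mul K (ideal_exp mm r) (coord_var X l ^+ r.+1).
  apply/hr/irrelevant_expP => j d dr.
  by rewrite rmorphXn /= ray_var exprZn coefZ coefXn ltn_eqF ?mulr0.
case=> a [u [v [hu hv E]]].
have [/existsP[t ht]|] := boolP [exists t, (ray i (u t))`_1 != 0]; first by exists (u t).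
rewrite negb_exists => /forallP u1; exfalso.
have := congr1 (fun g => (ray i g)`_r.+1) E.
rewrite rmorphXn /= ray_var exprZn coefZ coefXn eqxx mulr1 rmorph_sum coef_sum.
rewrite big1 => [|t _]; first by apply/eqP; rewrite expf_neq0.
rewrite rmorphM coefM big1 // => -[[|[|e]] /= er] _.
- by rewrite (irrelevant_order (KI _ (hu t))) ?mul0r.
- by move: (u1 t); rewrite negbK => /eqP ->; rewrite mul0r.
- have /irrelevant_expP -> := hv t; first by rewrite mulr0.
  by rewrite subSS ltn_subrL /=; case: r er {hr E hv}.
Qed.

Lemma reduction_generic K : infinite_field k -> reduction K mm ->
  exists2 y, K y & forall i, (ray i y)`_1 != 0.
Proof.
move=> k_inf redK; have [[K0 KD KM] _ _] := redK.
pose V (u : 'I_(size X) -> k) := exists2 y, K y & forall i, u i = (ray i y)`_1.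
have [||i _|u [y Ky uE] u0] := @general_position k _ (enum 'I_(size X)) V k_inf.
- by exists (fun i => (ray i 0)`_1), 0.
- move=> u v c [y Ky uE] [z Kz vE]; exists (y + coord_scalar X c * z).
    by apply: KD => //; apply: KM.
  by move=> i; rewrite rmorphD rmorphM /= ray_scalar coefD coefCM uE vE mulrC.
- have [y Ky yi] := reduction_coef1 i redK.
  by exists (fun i => (ray i y)`_1) => //; exists y.
- by exists y => // i; rewrite -uE; apply: u0; rewrite mem_enum.
Qed.

(** K contains m^N for N large, and one goes down to N = s + 1: the part of degree N
of g is y z for a z from [conductor], with y in K as in [reduction_generic], up to
terms of degree greater than N. *)
Lemma reduction_contains s K : infinite_field k -> all_separated s ->
  reduction K mm -> forall g, vanish_order s.+1 g -> K g.
Proof.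
move=> k_inf hs redK; have [y Ky y1] := reduction_generic k_inf redK.
have [[K0 KD KM] Km [r hr]] := redK.
have hbig N : (r < N)%N -> forall g, vanish_order N g -> K g.
  move=> rN g hg; have /hr[a [u [v [hu _ ->]]]] : ideal_exp mm r.+1 g.
    by apply/irrelevant_expP => i d dr; apply: hg; apply: leq_trans dr rN.
  by apply: ideal_sum => // t _; rewrite mulrC; apply: KM.
suff step N : (s < N)%N -> (forall g, vanish_order N.+1 g -> K g) ->
    forall g, vanish_order N g -> K g.
  have : exists t, (r < t + s.+1)%N by exists r.+1; rewrite leq_addr.
  case=> t; have := ltnSn s; move: {-1}s.+1 => N.
  elim: t N => [|t IH] N sN tN; first exact: hbig.
  by apply: (step N sN); apply: (IH N.+1 (leqW sN)); rewrite addnS -addSn.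
move=> sN IH g hg.
have [z hz] := conductor hs (fun i => ((ray i g)`_N / (ray i y)`_1) *: 'X^(N - s.+1)).
rewrite -[g](subrK (z * y)); apply: KD; last exact: KM.
have zE i : ray i z = ((ray i g)`_N / (ray i y)`_1) *: 'X^(N.-1).
  by rewrite hz -scalerAl -exprD; case: (N) sN => // N'; rewrite ltnS => sN'; rewrite subSS subnK.
apply: IH => i d; rewrite ltnS leq_eqVlt rmorphB rmorphM /= zE coefB -scalerAl coefZ coefXnM.
case: N sN hg {hz zE} => // N _ hg; rewrite /= => /orP[/eqP ->|dN].
  by rewrite ltnNge leqnSn /= subSn // subnn divfK ?subrr.
rewrite hg // sub0r; case: ltnP => [_|Nd]; first by rewrite mulr0 oppr0.
have -> : d = N by apply/eqP; rewrite eqn_leq Nd -ltnS dN.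
by rewrite subnn [(ray i y)`_0](irrelevant_order (Km _ Ky)) // mulr0 oppr0.
Qed.

End Separators.

(** * The Cayley-Bacharach property *)

Section Duality.
Variables (k : fieldType) (n : nat) (X : point_set k n).
Local Notation S := {mpoly k[n.+1]}.
Local Notation ptX := (@pt k n X).

(** If the basis vector e_i is not in the space V_d of the values of forms of degree
d, a linear form on k^s vanishes on V_d but not at e_i.  V_d is the row space of
the matrix of values of a basis of forms, and such linear forms are the columns of
its cokernel. *)
Lemma not_separated_dual d (i : 'I_(size X)) : ~ separated d i ->
  exists phi : 'I_(size X) -> k, phi i != 0 /\
    forall p : S, p \is d.-homog -> \sum_j phi j * p.@[ptX j 0] = 0.
Proof.
move=> nsep; pose B := vbasis {: dhomog n.+1 k d}.
pose M := \matrix_(r < \dim {: dhomog n.+1 k d}, j < size X)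
  (mpoly_of_dhomog B`_r).@[ptX j 0].
have evB (a : 'I_(\dim {: dhomog n.+1 k d}) -> k) j :
    (mpoly_of_dhomog (\sum_r a r *: B`_r)).@[ptX j 0] = \sum_r a r * M r j.
  rewrite !raddf_sum; apply: eq_bigr => r _.
  by rewrite /= linearZ /= ?mevalZ mxE.
have : ~~ ((delta_mx 0 i : 'rV_(size X)) <= M)%MS.
  apply/negP => /submxP[D DM]; apply: nsep.
  exists (mpoly_of_dhomog (\sum_r D 0 r *: B`_r)); first exact: dhomog_is_dhomog.
  move=> j; rewrite evB; have := congr1 (fun A : 'rV_(size X) => A 0 j) DM.
  by rewrite !mxE eqxx => <-.
rewrite submxE -rowE => /rV0Pn[c]; rewrite mxE => ic.
exists (fun j => cokermx M j c); split=> // p hp.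
have [f ->] : exists f : dhomog n.+1 k d, p = mpoly_of_dhomog f by exists (DHomog hp).
rewrite [f](coord_vbasis (memvf f)).
under eq_bigr do rewrite evB mulr_sumr.
rewrite exchange_big big1 //= => r _.
have := congr1 (fun A : 'M_(_, size X) => A r c) (mulmx_coker M); rewrite !mxE => E.
transitivity (coord B r f * \sum_j M r j * cokermx M j c); last by rewrite E mulr0.
by rewrite mulr_sumr; apply: eq_bigr => j _; rewrite mulrC -mulrA.
Qed.

Local Notation evd d P := (linfun (fun f : dhomog n.+1 k d => (mpoly_of_dhomog f).@[P 0%R] : k^o)).

Lemma evdE d (P : 'rV[k]_n.+1) f : evd d P f = (mpoly_of_dhomog f).@[P 0].
Proof.
have lin : linear (fun f : dhomog n.+1 k d => (mpoly_of_dhomog f).@[P 0] : k^o).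
  by move=> c p q /=; rewrite linearP.
pose L := GRing.isLinear.Build _ _ _ _ _ lin.
pose F : {linear _ -> k^o} := HB.pack
  (fun f : dhomog n.+1 k d => (mpoly_of_dhomog f).@[P 0] : k^o) L.
exact: (lfunE F).
Qed.

Lemma mem_vanishing_compP (Y : seq 'rV[k]_n.+1) d f :
  reflect (forall P, P \in Y -> (mpoly_of_dhomog f).@[P 0] = 0)
          (f \in vanishing_comp Y d).
Proof.
rewrite /vanishing_comp; apply: (iffP idP).
  elim: Y => [|Q Y IH]; first by [].
  rewrite big_cons memv_cap memv_ker evdE => /andP[/eqP fQ /IH h] P.
  by rewrite inE => /orP[/eqP ->|/h].
elim: Y => [|Q Y IH] h; first by rewrite big_nil memvf.
rewrite big_cons memv_cap memv_ker evdE h ?mem_head // eqxx IH // => P PY.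
by rewrite h // inE PY orbT.
Qed.

(** [hilbert_function_rem] shows that this rank, which is 0 or 1, is the amount by
which the Hilbert function drops in degree d when P_i is removed. *)
Definition hilbert_drop d (i : 'I_(size X)) : nat :=
  \dim (evd d (ptX i) @: vanishing_comp (rem (ptX i) X) d).

Lemma hilbert_drop_le1 d i : (hilbert_drop d i <= 1)%N.
Proof. by apply: leq_trans (dimvS (subvf _)) _; rewrite dimvf. Qed.

Lemma hilbert_drop_neq0 d i : hilbert_drop d i <> 0%N <-> separated d i.
Proof.
split=> [/eqP|[p hp pE]].
  rewrite dimv_eq0 => /negP h; apply: Classical_Prop.NNPP => nsep; apply: h; apply/eqP.
  apply/vspaceP => c; apply/idP/idP => [/memv_imgP[f /mem_vanishing_compP hf ->]|]; last first.
    by rewrite memv0 => /eqP ->; apply: mem0v.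
  rewrite memv0 evdE; apply/negP => /negP fi; apply: nsep.
  apply: (separated_of_neq0 (dhomog_is_dhomog f)) => // j ji.
  apply: hf; rewrite mem_rem_uniq ?points_uniq // inE pt_in andbT.
  by apply: contraNneq ji => /pt_inj ->.
apply/eqP; rewrite dimv_eq0; apply/negP => /eqP /vspaceP /(_ 1).
rewrite memv0 oner_eq0 => /negP; apply; apply/memv_imgP; exists (DHomog hp).
  apply/mem_vanishing_compP => P; rewrite mem_rem_uniq ?points_uniq // inE.
  case/andP => Pi /ptP[j Pj]; rewrite Pj pE; have [ji|//] := eqVneq j i.
  by rewrite Pj ji eqxx in Pi.
by rewrite evdE /= pE eqxx.
Qed.

(** The forms vanishing on X are the forms vanishing on the other points whose value
at P_i is zero: rank-nullity for the evaluation at P_i. *)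
Lemma hilbert_function_rem d i : (hilbert_function (rem (ptX i) X) d + hilbert_drop d i =
   hilbert_function X d)%N.
Proof.
have E : vanishing_comp X d =
    (vanishing_comp (rem (ptX i) X) d :&: lker (evd d (ptX i)))%VS.
  by rewrite {1}/vanishing_comp (big_rem (ptX i)) ?pt_in //= capvC.
have := limg_ker_dim (evd d (ptX i)) (vanishing_comp (rem (ptX i) X) d).
rewrite -E -/(hilbert_drop d i) => hdim; rewrite /hilbert_function -hdim.
by rewrite subnDA subnK // leq_subRL ?dimvS ?subvf // hdim dimvS ?subvf.
Qed.

(** The drop in degree d is 1 if P_i is separated in degree d and 0 otherwise, so
equality of the Hilbert functions is equality of the drops. *)
Lemma cayley_bacharachP : cayley_bacharach X <->
  forall d (i j : 'I_(size X)), separated d i -> separated d j.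
Proof.
split=> [h d i j /hilbert_drop_neq0 gi|h P Q /ptP[i ->] /ptP[j ->] d].
  apply/hilbert_drop_neq0 => gj; apply: gi; have := hilbert_function_rem d i.
  rewrite (h _ _ (pt_in i) (pt_in j)) -(hilbert_function_rem d j) gj.
  by move/addnI.
apply/eqP; rewrite -(eqn_add2r (hilbert_drop d i)) hilbert_function_rem.
rewrite -(hilbert_function_rem d j) eqn_add2l; apply/eqP.
have := hilbert_drop_le1 d i; have := hilbert_drop_le1 d j; have := hilbert_drop_neq0 d i; have := hilbert_drop_neq0 d j.
case: (hilbert_drop d i) (hilbert_drop d j) => [|[|//]] [|[|//]] // hj hi _ _.
  by have /h-/(_ i)/hi : separated d j by apply/hj.
by have /h-/(_ j)/hj : separated d i by apply/hi.
Qed.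

End Duality.

(** * The a-invariant *)

Section AInvariant.
Variables (k : fieldType) (n : nat) (X : point_set k n).
Local Notation S := {mpoly k[n.+1]}.
Local Notation R := (coord_ring X).
Local Notation pr := (coord_proj X).
Local Notation ptX := (@pt k n X).
Local Notation deg := (@coord_deg k n X).
Local Notation var := (coord_var X).

(** Setting t = 1 evaluates a polynomial at the chosen coordinate vector of P_i. *)
Definition pval (i : 'I_(size X)) : R -> k := horner_eval 1 \o ray i.
HB.instance Definition _ i := GRing.RMorphism.on (pval i).

Lemma pval_proj i p : pval i (pr p) = p.@[ptX i 0].
Proof. by rewrite /pval /= /horner_eval ray_proj cone_eval_at1. Qed.

Lemma pval_var i j : pval i (var j) = ptX i 0 j.
Proof. by rewrite pval_proj mevalXU. Qed.

Lemma ray_deg i d g : deg (Posz d) g -> ray i g = pval i g *: 'X^d.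
Proof. by case=> p hp ->; rewrite ray_proj pval_proj (cone_eval_homog _ hp). Qed.

Lemma frac_eq_pval i f u v : frac_eq f u v -> pval i f != 0 ->
  pval i f ^+ v.2 * pval i u.1 = pval i f ^+ u.2 * pval i v.1.
Proof.
case=> M /(congr1 (pval i)); rewrite !rmorphM !rmorphXn => + f0.
by apply: mulfI; rewrite expf_neq0.
Qed.

(** The cocycle condition on the overlap of the charts x_j and x_l, read at a point
of this overlap: a 1-cochain of fractions that agree there has a value at each
point. *)
Lemma cocycle_pval d u i j l : cocycle deg var d u ->
  ptX i 0 j != 0 -> ptX i 0 l != 0 ->
  pval i (u j).1 = ptX i 0 j ^+ (u j).2 * (pval i (u l).1 / ptX i 0 l ^+ (u l).2).
Proof.
case=> _ /(_ j l)/(@frac_eq_pval i) h Pj Pl.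
move: h; rewrite rmorphM /= !pval_var mulf_neq0 // => /(_ isT).
rewrite !rmorphM !rmorphXn /= !pval_var !exprMn => h.
have a0 := expf_neq0 (u l).2 Pj; have b0 := expf_neq0 (u l).2 Pl.
have c0 := expf_neq0 (u j).2 Pl.
apply: (mulfI (mulf_neq0 (mulf_neq0 a0 b0) c0)).
rewrite -!mulrA in h *; rewrite h; field.
by rewrite b0.
Qed.

(** A cocycle of degree d is determined by its values at the points, and when all
the points are separated in degree d these values are those of a form of degree
d.  Hence H^1_m(R) is zero in this degree. *)
Lemma cocycle_coboundary d u : all_separated X d -> cocycle deg var (Posz d) u ->
  coboundary deg var (Posz d) u.
Proof.
move=> hd cu; have [jj hjj] := fin_all_exists (@pt_coord k n X).
have [p hp pE] := interpolate hd
  (fun i => pval i (u (jj i)).1 / ptX i 0 (jj i) ^+ (u (jj i)).2).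
exists (pr p); first by exists p.
move=> j; exists 1%N; apply: ray_inj => i.
have degu : deg (Posz (d + (u j).2)) (u j).1 by rewrite PoszD; apply: cu.1.
rewrite !rmorphM !rmorphXn /= ray_var (ray_deg i degu) ray_proj (cone_eval_homog _ hp) pE.
have [->|Pj] := eqVneq (ptX i 0 j) 0; first by rewrite scale0r expr1 !mul0r.
rewrite (cocycle_pval cu Pj (hjj i)) expr0 mul1r; congr (_ * _).
by rewrite exprZn -scalerAl -scalerAr scalerA -exprD addnC.
Qed.

(** In degree d = s - 1 the values of forms do not fill k^s, so a nonzero linear
form phi on k^s vanishes on them; composed with the evaluation of cocycles at the
points, it is an element of the dual of H^1_m(R).  All vectors of k^s are values of
cocycles with denominators x_j, as the numerators have degree s, where the points
are separated. *)
Lemma canonical_comp_neq0_regularity s : all_separated X s ->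
  (forall d, (d < s)%N -> ~ all_separated X d) ->
  canonical_comp_neq0 (coord_scalar X) deg var (- (s%:Z - 1)).
Proof.
move=> hs smin.
have [phi [i0 [phi0 phiV]]] : exists (phi : 'I_(size X) -> k) i0, phi i0 != 0 /\
    forall h, deg (s%:Z - 1) h -> \sum_j phi j * pval j h = 0.
  (* In degree -1, that is s = 0, R vanishes and any phi will do. *)
  case: s {hs} smin => [_|s smin].
    have X0 : (0 < size X)%N by rewrite lt0n size_eq0 points_nonempty.
    pose i0 := Ordinal X0.
    exists (fun=> 1), i0; split=> [|_ ->]; first exact: oner_neq0.
    by rewrite big1 // => j _; rewrite rmorph0 mulr0.
  have /Classical_Pred_Type.not_all_ex_not[i0 ni0] := smin s (ltnSn s).
  have [phi [phi0 phiV]] := not_separated_dual ni0.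
  exists phi, i0; split=> // h; rewrite -addn1 PoszD addrK => -[p hp ->].
  by rewrite -[RHS](phiV _ hp); apply: eq_bigr => j _; rewrite pval_proj.
have [jj hjj] := fin_all_exists (@pt_coord k n X).
pose Phi (u : cochain R n.+1) :=
  \sum_i phi i * (pval i (u (jj i)).1 / ptX i 0 (jj i) ^+ (u (jj i)).2).
have [q hq] : exists q : 'I_n.+1 -> S, forall j, q j \is s.-homog /\
    forall i, (q j).@[ptX i 0] = (i == i0)%:R * ptX i 0 j.
  apply: (fin_all_exists (P := fun j (q : S) => q \is s.-homog /\
    forall i, q.@[ptX i 0] = (i == i0)%:R * ptX i 0 j)) => j.
  by have [p] := interpolate hs (fun i => (i == i0)%:R * ptX i 0 j); exists p.
pose u : cochain R n.+1 := fun j => (pr (q j), 1%N).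
exists Phi, u; rewrite /canonical_comp opprK; split; first split.
- move=> v w _ _; rewrite /Phi -big_split; apply: eq_bigr => i _ /=.
  rewrite -mulrDr rmorphD !rmorphM !rmorphXn /= pval_var; congr (_ * _).
  have a0 := expf_neq0 (v (jj i)).2 (hjj i); have b0 := expf_neq0 (w (jj i)).2 (hjj i).
  by rewrite exprD; field; rewrite b0.
- move=> c v _; rewrite /Phi mulr_sumr; apply: eq_bigr => i _ /=.
  rewrite rmorphM /= [pval i (coord_scalar X c)](_ : _ = c); last first.
    by rewrite pval_proj mevalC.
  by rewrite -[c * _ / _]mulrA mulrCA.
- move=> v _ [h hdeg hv]; rewrite -(phiV h hdeg); apply: eq_bigr => i _; congr (_ * _).
  have := frac_eq_pval (hv (jj i)) (i := i); rewrite pval_var => /(_ (hjj i)) /=.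
  by rewrite expr0 mul1r => ->; rewrite mulrAC divff ?mul1r // expf_neq0.
- split=> [j|j l] /=; first by rewrite subrK; exists (q j); [have [] := hq j|].
  exists 0%N; rewrite !expr0 !expr1 !mul1r; congr (_ * _); apply: ray_inj => i.
  have [hj Ej] := hq j; have [hl El] := hq l.
  rewrite !rmorphM /= !ray_var !ray_proj (cone_eval_homog _ hj) (cone_eval_homog _ hl) Ej El.
  by rewrite -!scalerAl -!scalerAr !scalerA; congr (_ *: _); ring.
- rewrite /Phi (bigD1 i0) //= big1 => [|i /negbTE ii0].
    by rewrite addr0 pval_proj (hq _).2 eqxx mul1r expr1 divff ?mulr1.
  by rewrite pval_proj (hq _).2 ii0 !mul0r mulr0.
Qed.

(** H^1_m(R) is zero in degrees at least s and nonzero in degree s - 1, and these two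
properties determine the number s - 1. *)
Lemma a_invariantE s : all_separated X s ->
  (forall d, (d < s)%N -> ~ all_separated X d) -> a_invariant X = s%:Z - 1.
Proof.
move=> hs smin.
have is_a : is_a_invariant (coord_scalar X) deg var (s%:Z - 1).
  split; first exact: canonical_comp_neq0_regularity.
  move=> i [phi [u [[_ _ phi0] cu]]]; apply: contraNT; rewrite -ltNge => hi.
  have : s%:Z <= - i by rewrite -[_ <= _]lerN2 opprK; move: hi; rewrite opprB; lia.
  move: phi0 cu; case: (- i) => // e phi0 cu se; apply/eqP/phi0 => //.
  by apply: cocycle_coboundary => // j; apply: separated_leq (hs j).
have : is_a_invariant (coord_scalar X) deg var (a_invariant X).
  by apply: ClassicalEpsilon.epsilon_spec; exists (s%:Z - 1).
case: is_a => a1 a2 [b1 b2]; apply/eqP; rewrite eq_le.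
by have := b2 _ a1; have := a2 _ b1; rewrite !lerN2 => -> ->.
Qed.

End AInvariant.

(** * The core *)

Section CoreOfPoints.
Variables (k : fieldType) (k_inf : infinite_field k) (n : nat) (X : point_set k n).
Local Notation S := {mpoly k[n.+1]}.
Local Notation R := (coord_ring X).
Local Notation pr := (coord_proj X).
Local Notation mm := (irrelevant_ideal X).
Local Notation ptX := (@pt k n X).

(** The element is e_i t^(s+1), obtained from a separator p of P_i in degree s by
multiplying with a coordinate.  For y in a reduction K with nonzero linear part at
P_i, a scalar multiple of p y agrees with it modulo elements of order s + 2, all of
which lie in K by [reduction_contains]. *)
Lemma separated_core_element s (i : 'I_(size X)) : all_separated X s.+1 -> separated s i ->
  exists2 g, core_of_points X g & ~ vanish_order s.+2 g.
Proof.
move=> hs [p hp pE]; have [l Pl] := pt_coord i.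
have rayp := ray_separator pE hp.
pose g := pr p * coord_var X l.
have gE j : ray j g = ((j == i)%:R * ptX i 0 l) *: 'X^(s.+1).
  rewrite rmorphM /= rayp ray_var; case: eqP => [->|_]; last by rewrite !scale0r !mul0r scale0r.
  by rewrite scale1r mul1r -scalerAr -exprSr.
clearbody g; exists g; last first.
  by move/(_ i s.+1 (ltnSn _))/eqP; rewrite gE eqxx mul1r coefZ coefXn eqxx mulr1 (negbTE Pl).
move=> K redK; have [y Ky y1] := reduction_generic k_inf redK.
have [[K0 KD KM] Km _] := redK.
pose c := coord_scalar X (ptX i 0 l / (ray i y)`_1).
rewrite -[g](subrK (c * pr p * y)); apply: KD; last exact: KM.
apply: (reduction_contains k_inf hs redK) => j d ds.
rewrite rmorphB !rmorphM /= gE ray_scalar rayp coefB coefZ coefXn.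
have [->|_] := eqVneq j i; last by rewrite !mul0r !scale0r mulr0 mul0r coef0 subr0.
rewrite mul1r scale1r -mulrA coefCM coefXnM.
move: ds; rewrite ltnS leq_eqVlt => /orP[/eqP ->|ds].
  by rewrite eqxx ltnNge leqnSn /= subSn // subnn mulr1 divfK // subrr.
rewrite (ltn_eqF ds) mulr0; case: ltnP => [_|sd]; first by rewrite mulr0 subr0.
have -> : d = s by apply/eqP; rewrite eqn_leq sd -ltnS ds.
by rewrite subnn [(ray i y)`_0](irrelevant_order (Km _ Ky)) // mulr0 subr0.
Qed.

(** The linear forms through P_i form a space in which, for each other point, some
member does not vanish there; [general_position] finds one that works for all. *)
Lemma linear_form_through i : exists2 p : S, p \is 1.-homog &
  forall j, (p.@[ptX j 0] == 0) = (j == i).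
Proof.
pose V (u : 'I_(size X) -> k) := exists p : S,
  [/\ p \is 1.-homog, p.@[ptX i 0] = 0 & forall j, u j = p.@[ptX j 0]].
have [| |j|u [p [hp pi uE]] u0] :=
    @general_position k _ (enum (predC1 i)) V k_inf.
- by exists (fun j => 0), 0; split=> [||j]; rewrite ?dhomog0 ?meval0.
- move=> u v c [p [hp pi uE]] [q [hq qi vE]]; exists (p + c *: q).
  split=> [||j]; first by rewrite rpredD // dhomogZ.
    by rewrite mevalD mevalZ pi qi mulr0 addr0.
  by rewrite mevalD mevalZ uE vE mulrC.
- rewrite mem_enum => /= ij; have [|p hp [pi pj]] := @linear_separator _ _ X j i.
    by rewrite eq_sym.
  by exists (fun j => p.@[ptX j 0]) => //; exists p.
exists p => // j; have [->|ji] := eqVneq j i; first by rewrite pi eqxx.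
by apply/negbTE; rewrite -uE u0 // mem_enum.
Qed.

(** Fix a linear form p vanishing on X at P_i only, and a coordinate x_l nonzero at
P_i.  For all but finitely many c the form p + c x_l has no zero on X, so it
generates a reduction and g is divisible by it.  If P_i were not separated in
degree d - 1, a linear form phi nonzero at e_i and vanishing on V_(d-1) would give
sum_j phi_j g_j / (p + c x_l)(P_j) = 0 for these c.  Clearing denominators yields a
polynomial in c with infinitely many zeros, while its value at c = 0 is
phi_i g_i times the product of the p(P_j) for j <> i, which is nonzero. *)
Lemma core_separated d g i : core_of_points X g -> (ray i g)`_d != 0 ->
  exists2 e, d = e.+1 & separated e i.
Proof.
move=> core_g gi; have [s hs] := all_separated_ex X.
have [p hp p0] := linear_form_through i; have [l Pl] := pt_coord i.
pose L j : {poly k} := (p.@[ptX j 0])%:P + ptX j 0 l *: 'X.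
have L0 j : L j != 0.
  apply/eqP => /polyP Lj; have [ji|/negbTE ji] := eqVneq j i.
    by have /eqP := Lj 1%N; rewrite ji coefD coefC coefZ coefX mulr1 add0r coef0 (negbTE Pl).
  by have /eqP := Lj 0%N; rewrite coefD coefC coefZ coefX mulr0 addr0 coef0 p0 ji.
have divisible c : (forall j, (L j).[c] != 0) ->
    exists z, forall j, ray j g = (L j).[c] *: 'X * ray j z.
  move=> Lc; have lE j : ray j (pr (p + c *: 'X_l)) = (L j).[c] *: 'X.
    rewrite ray_proj rmorphD /= (cone_eval_homog _ hp) -mul_mpolyC rmorphM /=.
    rewrite cone_eval_const cone_eval_var mul_polyC scalerA -scalerDl.
    by rewrite hornerD hornerC hornerZ hornerX [c * _]mulrC.
  have [z ->] := core_g _ (principal_reduction hs Lc lE).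
  by exists z => j; rewrite rmorphM /= lE.
have [e de] : exists e, d = e.+1.
  case: d gi => [|e] gi; last by exists e.
  have PL0 : \prod_j L j != 0 by apply/prodf_neq0.
  have [c] := infinite_nonroot k_inf PL0; rewrite horner_prod => /prodf_neq0 Lc.
  have [z zE] := divisible c (fun j => Lc j isT).
  by case/eqP: gi; rewrite zE -scalerAl coefZ coefXM mulr0.
exists e => //; apply: Classical_Prop.NNPP => /not_separated_dual[phi [phi0 phiV]].
(* F(c) is the sum over j of phi_j g_j / L_j(c), times the product of all L_j(c). *)
pose F := \sum_j (phi j * (ray j g)`_d) *: \prod_(h | h != j) L h.
have F0 : F != 0.
  apply: contra_neq phi0 => /(congr1 (horner^~ 0)); rewrite horner_sum horner0.
  rewrite (bigD1 i) //= [X in _ + X]big1 => [|j ji]; last first.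
    rewrite hornerZ horner_prod (bigD1 i) 1?eq_sym //= hornerD hornerC hornerZ hornerX.
    by rewrite mulr0 addr0 (eqP (_ : p.@[ptX i 0] == 0)) ?p0 // mul0r mulr0.
  rewrite addr0 hornerZ => /eqP; rewrite !mulf_eq0 (negbTE gi) orbF => /orP[/eqP //|].
  rewrite horner_prod => /prodf_eq0[j ji].
  by rewrite hornerD hornerC hornerZ hornerX mulr0 addr0 p0 (negbTE ji).
have G0 : F * \prod_j L j != 0 by rewrite mulf_neq0 //; apply/prodf_neq0.
have [c] := infinite_nonroot k_inf G0; rewrite hornerM mulf_eq0 negb_or.
rewrite [(\prod_j L j).[c]]horner_prod => /andP[+ /prodf_neq0 Lc].
have [z zE] := divisible c (fun j => Lc j isT); have [q zq] := proj_surj z.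
case/eqP; have := phiV _ (pihomogP mdeg e q) => phi_q.
transitivity ((\prod_j (L j).[c]) * \sum_j phi j * (pihomog mdeg e q).@[ptX j 0]).
  rewrite horner_sum mulr_sumr; apply: eq_bigr => j _.
  rewrite hornerZ horner_prod zE -scalerAl coefZ coefXM de /= zq ray_proj coef_cone_eval.
  by rewrite [in RHS](bigD1 j) //=; ring.
by rewrite phi_q mulr0.
Qed.

End CoreOfPoints.

(* The exponent a + 2 is at least 1, so the absolute value absz is only a cast to nat. *)
Theorem corollary5p5 (k : fieldType) (k_inf : infinite_field k) (n : nat)
    (X : point_set k n) :
  cayley_bacharach X <->
  eqideal (core_of_points X)
          (ideal_exp (irrelevant_ideal X) (absz (a_invariant X + 2))).
Proof.
have [s [hs smin]] := least_nat (all_separated_ex X).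
have -> : absz (a_invariant X + 2) = s.+1 by rewrite (a_invariantE hs smin); lia.
have core_ge g : vanish_order s.+1 g -> core_of_points X g.
  by move=> hg K redK; apply: (reduction_contains k_inf hs redK).
split=> [/cayley_bacharachP cb g|core_eq].
  split=> [core_g|/irrelevant_expP]; last exact: core_ge.
  apply/irrelevant_expP => i d ds; apply/eqP/negPn/negP => gi.
  have [e de sep_i] := core_separated k_inf core_g gi.
  apply: (smin e); first by rewrite de ltnS in ds.
  by move=> j; apply: cb sep_i.
apply/cayley_bacharachP => d i j sep_i.
have [sd|ds] := leqP s d; first exact: separated_leq sd (hs j).
case: s hs smin ds core_ge core_eq => // s hs _ ds _ core_eq.
have [g /core_eq/irrelevant_expP core_g []] :=
  separated_core_element k_inf hs (@separated_leq _ _ _ d s i ds sep_i).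
exact: core_g.
Qed.
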